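(* Let $n\ge0$, let $\mathbf{A}$ be a set partition of $[n]$ with $r$ parts, and let $\Gamma(r)$ denote the set of all set compositions of $[r]$. The antipode $S$ of the Hopf algebra $\mathrm{NCSym}$ acts on $\mathbf{A}$ by $$S(\mathbf{A})=\sum_{\gamma\in\Gamma(r)}(-1)^{\ell(\gamma)}\,\gamma[\mathbf{A}].$$
   Context: Let $\mathbb{P}$ be the set of positive integers, $[n]=\{1,\dots,n\}$ and $[0]=\emptyset$. Set partitions. A set partition of a finite set $X\subseteq\mathbb{P}$ is a set $\mathbf{A}=\{A_1,\dots,A_r\}$ of nonempty, pairwise disjoint subsets (parts) of $X$ with union $X$. Parts are always indexed in increasing order of their minimum elements. The empty set has a unique set partition, denoted $\boldsymbol{\emptyset}$ (with $r=0$ parts). Let $\Pi(n)$ be the set of set partitions of $[n]$. For a set partition $\mathbf{A}$ with $r$ parts and $K\subseteq[r]$, let $\mathbf{A}_K=\{A_k\mid k\in K\}$. For a set partition $\mathbf{A}$ of an $n$-element set $X$, its standardization $\mathbf{A}^{\downarrow}\in\Pi(n)$ is the pullback of $\mathbf{A}$ along the unique increasing bijection $[n]\to X$. For $\mathbf{B}\in\Pi(m)$ and $\mathbf{C}\in\Pi(n)$, $\mathbf{B}|\mathbf{C}\in\Pi(m+n)$ is the set partition $\mathbf{B}\cup\mathbf{C}^{+m}$, where $\mathbf{C}^{+m}$ is obtained from $\mathbf{C}$ by adding $m$ to every element of every part. Set compositions. A set composition of a finite set $K\subseteq\mathbb{P}$ is a sequence $\gamma=(\gamma_1,\dots,\gamma_s)$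 of nonempty, pairwise disjoint subsets of $K$ with union $K$; its length is $\ell(\gamma)=s$. The empty set has a unique set composition, the empty sequence, of length $0$. If $\mathbf{A}$ is a set partition with $r$ parts and $\gamma=(\gamma_1,\dots,\gamma_s)$ is a set composition of some $K\subseteq[r]$, define $$\gamma[\mathbf{A}] := (\mathbf{A}_{\gamma_1})^{\downarrow}\,|\,(\mathbf{A}_{\gamma_2})^{\downarrow}\,|\,\cdots\,|\,(\mathbf{A}_{\gamma_s})^{\downarrow}$$ (equal to $\boldsymbol{\emptyset}$ when $s=0$). The Hopf algebra. $\mathrm{NCSym}=\bigoplus_{n\ge0}\mathrm{NCSym}_n$ is the graded $\mathbb{Q}$-vector space where $\mathrm{NCSym}_n$ has basis $\Pi(n)$. It is a graded connected cocommutative Hopf algebra with product $\mathbf{A}\cdot\mathbf{B}=\mathbf{A}|\mathbf{B}$, unit $\boldsymbol{\emptyset}$, coproduct $$\Delta(\mathbf{A})=\sum_{(K,L)} (\mathbf{A}_K)^{\downarrow}\otimes(\mathbf{A}_L)^{\downarrow}$$ for $\mathbf{A}$ with $r$ parts, the sum being over ordered pairs $(K,L)$ of (possibly empty) subsets with $K\cup L=[r]$, $K\cap L=\emptyset$, and counit $\varepsilon(\mathbf{A})=0$ for $\mathbf{A}\ne\boldsymbol{\emptyset}$, $\varepsilon(\boldsymbol{\emptyset})=1$. *)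

(* Defs.v *)
From HB Require Import structures.
From mathcomp Require Import all_boot all_order all_algebra.
From mathcomp Require Import finmap zify.
From mathcomp.multinomials Require Export monalg.

Set Implicit Arguments.
Unset Strict Implicit.
Unset Printing Implicit Defensive.

Import GRing.Theory.
Local Open Scope ring_scope.

(* Everything is 0-based: [n] is 'I_n and the r parts of a set partition are
   indexed by 'I_r, in increasing order of their minima. *)
Definition setpart (n : nat) : Type :=
  {P : {set {set 'I_n}} | partition P [set: 'I_n]}.
HB.instance Definition _ n := Finite.copy (setpart n)
  {P : {set {set 'I_n}} | partition P [set: 'I_n]}.

Definition spart : Type := {n : nat & setpart n}.
HB.instance Definition _ := Choice.copy spart {n : nat & setpart n}.

Definition nparts n (A : setpart n) : nat := #|val A|.

Definition min_elt n (B : {set 'I_n}) : nat := \big[minn/n]_(i in B) (i : nat).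

Definition parts n (A : setpart n) : seq {set 'I_n} :=
  sort (fun B C => min_elt B <= min_elt C)%N (enum (val A)).

Definition subparts n (A : setpart n) (K : {set 'I_(nparts A)}) :
    {set {set 'I_n}} :=
  [set nth set0 (parts A) k | k : 'I_(nparts A) in K].

Arguments subparts {n} A K.

Lemma size_parts n (A : setpart n) : size (parts A) = nparts A.
Proof. by rewrite size_sort -cardE. Qed.

Lemma mem_parts n (A : setpart n) : parts A =i val A.
Proof. by move=> B; rewrite mem_sort mem_enum. Qed.

Lemma subparts_sub n (A : setpart n) (K : {set 'I_(nparts A)}) :
  subparts A K \subset val A.
Proof.
apply/subsetP=> B /imsetP[k _ ->].
by rewrite -mem_parts mem_nth // size_parts.
Qed.

Lemma subparts_partition n (A : setpart n) (K : {set 'I_(nparts A)}) :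
  partition (subparts A K) (cover (subparts A K)).
Proof.
have /and3P[_ tA nA] := valP A; have sKA := subparts_sub K.
apply/and3P; split; first exact: eqxx.
  exact: trivIsetS sKA tA.
by apply: contra nA => /(subsetP sKA).
Qed.

(* enum_val is the increasing bijection from 'I_#|X| onto X. *)
Definition std_set n (X : {set 'I_n}) (P : {set {set 'I_n}}) :
    {set {set 'I_#|X|}} :=
  [set [set i | enum_val i \in B] | B : {set 'I_n} in P].

Lemma partitionP (T : finType) (P : {set {set T}}) (D : {set T}) :
  reflect [/\ forall x, x \in D -> exists2 B, B \in P & x \in B,
              forall B x, B \in P -> x \in B -> x \in D,
              forall B C x, B \in P -> C \in P -> x \in B -> x \in C -> B = C
            & set0 \notin P]
          (partition P D).
Proof.
apply: (iffP and3P) => [[/eqP<- tP nP]|[cov sub tP nP]].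
  split=> // [x /bigcupP[B BP xB]|B x BP xB|B C x BP CP xB xC].
  - by exists B.
  - by apply/bigcupP; exists B.
  by rewrite -(def_pblock tP BP xB) -(def_pblock tP CP xC).
split=> //.
  apply/eqP/setP=> x; apply/bigcupP/idP => [[B BP xB]|/cov[B BP xB]].
    exact: sub xB.
  by exists B.
apply/trivIsetP=> B C BP CP; apply: contraNT.
by case/pred0Pn=> x /andP[xB xC]; apply/eqP; apply: tP xC.
Qed.

Lemma std_set_partition n (X : {set 'I_n}) (P : {set {set 'I_n}}) :
  partition P X -> partition (std_set X P) [set: 'I_#|X|].
Proof.
case/partitionP=> cov sub tP nP; apply/partitionP; split=> //.
- move=> i _; have [B BP iB] := cov _ (enum_valP i).
  by exists [set j | enum_val j \in B]; rewrite ?inE //; apply: imset_f.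
- move=> _ _ i /imsetP[B BP ->] /imsetP[C CP ->]; rewrite !inE => iB iC.
  by rewrite (tP _ _ _ BP CP iB iC).
- apply/imsetP=> -[B BP /esym/setP B0].
  have [Be|[x xB]] := set_0Vmem B; first by rewrite -Be BP in nP.
  have xX := sub _ _ BP xB.
  by have := B0 (enum_rank_in xX x); rewrite !inE enum_rankK_in // xB.
Qed.

Definition std n (X : {set 'I_n}) (P : {set {set 'I_n}}) (hP : partition P X) :
    setpart #|X| :=
  Sub (std_set X P) (std_set_partition hP).

Definition std_sub n (A : setpart n) (K : {set 'I_(nparts A)}) : spart :=
  Tagged setpart (std (subparts_partition K)).

Arguments std_sub {n} A K.

Definition bar_set m n (P : {set {set 'I_m}}) (Q : {set {set 'I_n}}) :
    {set {set 'I_(m + n)}} :=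
  [set @lshift m n @: B | B : {set 'I_m} in P]
    :|: [set @rshift m n @: C | C : {set 'I_n} in Q].

Lemma bar_set_partition m n (B : setpart m) (C : setpart n) :
  partition (bar_set (val B) (val C)) [set: 'I_(m + n)].
Proof.
case/partitionP: (valP B) => covB _ tB nB.
case/partitionP: (valP C) => covC _ tC nC.
apply/partitionP; split=> //.
- move=> x _; case: (split_ordP x) => i ->.
    have [X XB iX] := covB i (in_setT _).
    by exists (@lshift m n @: X); rewrite ?inE !imset_f.
  have [X XC iX] := covC i (in_setT _).
  by exists (@rshift m n @: X); rewrite ?inE !imset_f ?orbT.
- move=> _ _ x /setUP[]/imsetP[X hX ->] /setUP[]/imsetP[Y hY ->]
    /imsetP[i iX ->] /imsetP[j jY] /eqP;
    rewrite ?eq_lshift ?eq_rshift ?eq_lrshift ?eq_rlshift // => /eqP ij;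
    rewrite -ij in jY.
    by rewrite (tB _ _ _ hX hY iX jY).
  by rewrite (tC _ _ _ hX hY iX jY).
- apply/negP=> /setUP[]/imsetP[X hX /esym/eqP]; rewrite imset_eq0 => /eqP X0.
    by rewrite -X0 hX in nB.
  by rewrite -X0 hX in nC.
Qed.

Definition bar m n (B : setpart m) (C : setpart n) : setpart (m + n) :=
  Sub (bar_set (val B) (val C)) (bar_set_partition B C).

Definition sbar (B C : spart) : spart :=
  Tagged setpart (bar (tagged B) (tagged C)).

Lemma empty_set_partition : partition set0 [set: 'I_0].
Proof. by apply/partitionP; split=> [[]|? ?|? ? ?|]; rewrite ?inE. Qed.

Definition sempty : spart :=
  Tagged setpart (Sub set0 empty_set_partition : setpart 0).

(* i and j lie in a common part.  A set partition is determined by its size and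
   this relation on nat, which avoids casts between the types setpart n. *)
Definition same (A : spart) (i j : nat) : bool :=
  [exists B in val (tagged A),
     [exists x in B, val x == i] && [exists x in B, val x == j]].

Lemma same_ord n (A : setpart n) (x y : 'I_n) :
  reflect (exists2 B, B \in val A & (x \in B) && (y \in B))
          (same (Tagged setpart A) x y).
Proof.
apply: (iffP exists_inP) => -[B BA] /= => [|/andP[xB yB]].
  case/andP=> /exists_inP[x' x'B /eqP/val_inj<-].
  by case/exists_inP=> y' y'B /eqP/val_inj<-; exists B; rewrite ?x'B.
exists B => //; apply/andP; split; apply/exists_inP.
  by exists x.
by exists y.
Qed.

Lemma same_lt (A : spart) i j : same A i j -> (i < tag A)%N && (j < tag A)%N.
Proof.
case/exists_inP=> B _ /andP[/exists_inP[x _ /eqP<-] /exists_inP[y _ /eqP<-]].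
by rewrite !ltn_ord.
Qed.

Lemma spart_eq (A B : spart) :
  tag A = tag B -> (forall i j, same A i j = same B i j) -> A = B.
Proof.
case: A B => [n A] [m B] /= nm; subst m => sAB; congr existT; apply: val_inj.
suff sub (P Q : setpart n) (sPQ : forall i j,
    same (Tagged setpart P) i j = same (Tagged setpart Q) i j) :
    val P \subset val Q.
  by apply/eqP; rewrite eqEsubset !sub.
apply/subsetP=> X XP.
case/partitionP: (valP P) => _ _ tP nP; case/partitionP: (valP Q) => _ _ tQ _.
have [X0|[x xX]] := set_0Vmem X; first by rewrite -X0 XP in nP.
have /same_ord[Y YQ /andP[xY _]] : same (Tagged setpart Q) x x.
  by rewrite -sPQ; apply/same_ord; exists X; rewrite // xX.
suff -> : X = Y by [].
apply/setP=> y; apply/idP/idP => [yX|yY].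
  have /same_ord[Z ZQ /andP[xZ yZ]] : same (Tagged setpart Q) x y.
    by rewrite -sPQ; apply/same_ord; exists X; rewrite // xX yX.
  by rewrite (tQ _ _ _ YQ ZQ xY xZ).
have /same_ord[Z ZP /andP[xZ yZ]] : same (Tagged setpart P) x y.
  by rewrite sPQ; apply/same_ord; exists Y; rewrite // xY yY.
by rewrite (tP _ _ _ XP ZP xX xZ).
Qed.

Lemma same_sbar (B C : spart) i j :
  same (sbar B C) i j =
  same B i j
  || [&& tag B <= i, tag B <= j & same C (i - tag B) (j - tag B)]%N.
Proof.
case: B C => [m B] [n C] /=; apply/exists_inP/orP => /=.
  case=> _ /setUP[]/imsetP[X hX ->] /andP[]
    /exists_inP[_ /imsetP[x xX ->] /eqP<-]
    /exists_inP[_ /imsetP[y yX ->] /eqP<-] /=.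
    by left; apply/same_ord; exists X; rewrite // xX yX.
  right; rewrite !leq_addr !addKn /=.
  by apply/same_ord; exists X; rewrite // xX yX.
case=> [s|/and3P[mi mj s]]; have /= /andP[ni nj] := same_lt s.
  have /same_ord[X hX /andP[xX yX]] : same (Tagged setpart B)
    (Ordinal ni) (Ordinal nj) by [].
  exists (@lshift m n @: X); first by rewrite inE imset_f.
  apply/andP; split; apply/exists_inP.
    by exists (lshift n (Ordinal ni)); rewrite ?imset_f.
  by exists (lshift n (Ordinal nj)); rewrite ?imset_f.
have /same_ord[X hX /andP[xX yX]] : same (Tagged setpart C)
  (Ordinal ni) (Ordinal nj) by [].
exists (@rshift m n @: X); first by rewrite inE imset_f ?orbT.
apply/andP; split; apply/exists_inP.
  by exists (rshift m (Ordinal ni)); rewrite ?imset_f //= subnKC.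
by exists (rshift m (Ordinal nj)); rewrite ?imset_f //= subnKC.
Qed.

Lemma same_sempty i j : same sempty i j = false.
Proof. by case h: (same _ _ _) => //; have /andP[] := same_lt h. Qed.

Lemma spart0 (A : spart) : tag A = 0%N -> A = sempty.
Proof.
move=> A0; apply: spart_eq => // i j; rewrite same_sempty.
by case h: (same _ _ _) => //; have := same_lt h; rewrite A0.
Qed.

Lemma sbarA : associative sbar.
Proof.
move=> A B C; apply: spart_eq => [|i j]; first exact: addnA.
rewrite !same_sbar /= -orbA -!subnDA; congr (_ || _).
case: (same B _ _) (same C _ _) => [] []; rewrite ?andbT ?andbF ?orbF ?orbT //;
  lia.
Qed.

Lemma sbar0s : left_id sempty sbar.
Proof.
move=> A; apply: spart_eq => // i j.
by rewrite same_sbar same_sempty /= !subn0.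
Qed.

Lemma sbars0 : right_id sempty sbar.
Proof.
move=> A; apply: spart_eq => [|i j]; first exact: addn0.
by rewrite same_sbar same_sempty !andbF orbF.
Qed.

Lemma sbar_eq0 (B C : spart) : sbar B C = sempty -> B = sempty /\ C = sempty.
Proof.
move/(congr1 tag)=> /= /eqP; rewrite addn_eq0 => /andP[/eqP B0 /eqP C0].
by split; apply: spart0.
Qed.

HB.instance Definition _ :=
  Choice_isMonomialDef.Build spart sbarA sbar0s sbars0 sbar_eq0.

(* The product of the monoid algebra is the bilinear extension of A|B, and its
   unit is the empty set partition. *)
Notation NCSym := {malg rat[spart]}.

Definition basis n (A : setpart n) : NCSym := << Tagged setpart A >>.

Lemma basisM m n (A : setpart m) (B : setpart n) :
  basis A * basis B = basis (bar A B).
Proof. by rewrite malgM_def fgmulUU mulr1. Qed.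

(* The tensor square, through its basis of pairs of set partitions. *)
Notation NCSym2 := {malg rat[(spart * spart)%type]}.

Definition coprod_basis n (A : setpart n) : NCSym2 :=
  \sum_(KL : {set 'I_(nparts A)} * {set 'I_(nparts A)} |
        (KL.1 :|: KL.2 == [set: 'I_(nparts A)]) && (KL.1 :&: KL.2 == set0))
     << (std_sub A KL.1, std_sub A KL.2) >>.

Definition coprod (x : NCSym) : NCSym2 :=
  \sum_(A <- msupp x) x@_A *: coprod_basis (tagged A).

Lemma coprod_basisE n (A : setpart n) : coprod (basis A) = coprod_basis A.
Proof.
by rewrite /coprod /basis msuppU oner_eq0 big_seq_fset1 mcoeffUU scale1r.
Qed.

Definition counit (x : NCSym) : rat := x@_(sempty).

(* The tensor product of f and g, followed by the multiplication. *)
Definition mul_tensor (f g : {linear NCSym -> NCSym}) (t : NCSym2) : NCSym :=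
  \sum_(p <- msupp t) t@_p *: (f << p.1 >> * g << p.2 >>).

Definition convolution (f g : {linear NCSym -> NCSym}) (x : NCSym) : NCSym :=
  mul_tensor f g (coprod x).

Definition is_antipode (S : {linear NCSym -> NCSym}) : Prop :=
  (forall x, convolution S idfun x = counit x *: 1) /\
  (forall x, convolution idfun S x = counit x *: 1).

Definition setcomp r (K : {set 'I_r}) (g : seq {set 'I_r}) : bool :=
  [&& set0 \notin g, pairwise (fun B C : {set 'I_r} => [disjoint B & C]) g
    & \bigcup_(B <- g) B == K].

Definition comp_act n (A : setpart n) (g : seq {set 'I_(nparts A)}) : spart :=
  \big[sbar/sempty]_(K <- g) std_sub A K.
Arguments comp_act {n} A g.

(* The set compositions of [r] thus form a subset of the finite type of sequences
   of length at most r. *)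
Lemma size_setcomp r (K : {set 'I_r}) (g : seq {set 'I_r}) :
  setcomp K g -> (size g <= r)%N.
Proof.
case/and3P=> ne dj _; suff: (size g <= #|\bigcup_(B <- g) B|)%N.
  by move/leq_trans; apply; rewrite -[leqRHS]card_ord max_card.
elim: g ne dj => [//|B g IH]; rewrite inE negb_or => /andP[Bn0 ne] /= /andP[dB dj].
rewrite big_cons cardsU disjoint_setI0 ?cards0 ?subn0.
  by rewrite -add1n leq_add ?IH // card_gt0 eq_sym.
elim: g dB {ne dj IH} => [|C g IH] /=; first by rewrite big_nil -setI_eq0 setI0.
by case/andP=> BC /IH; rewrite big_cons -!setI_eq0 setIUr setU_eq0 => ->;
  rewrite andbT setI_eq0.
Qed.

(* Main.v *)
Require Import Defs.
From mathcomp Require Import all_boot all_order all_algebra.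

Set Implicit Arguments.
Unset Strict Implicit.
Unset Printing Implicit Defensive.

Import GRing.Theory.
Local Open Scope ring_scope.

(** The convolution identity id * S = unit o counit determines S on a nonempty
    set partition from its values on those with fewer parts.  Evaluated at the
    standardization A_K of the parts of A indexed by a nonempty K, it isolates
    the term in which the left factor is the empty partition and gives
<<
      S(A_K) = - sum over nonempty L included in K of A_L * S(A_(K - L)).
>>
    A composition of a nonempty K is the choice of its first block L followed
    by a composition of K - L, and prepending L changes the sign and multiplies
    gamma[A] by A_L on the left.  Hence the alternating sum over the
    compositions of K satisfies the same recursion ([comp_sumS],
    [antipode_rec]), and both sides are 1 for K empty; induction on the
    cardinality of K finishes, and A itself is A_K for K the set of all
    indices ([std_subT]).

    The induction runs over the subsets K of the indices of one fixed A.  The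
    coproduct of A_K, however, is indexed by subsets of the indices of A_K, so
    the parts of A_K must be matched with the elements of K, and (A_K)_J must
    be recognized as some A_L ([std_sub_std_sub]).  This holds because
    standardizing twice is standardizing once, which follows from the
    uniqueness of increasing bijections ([std_unique]).  As the sum is over all
    subsets, any such matching of indices may be used to rewrite it
    ([convolution_std_sub]). *)

(** * Increasing maps between ordinals *)

Lemma increasing_inj m n (g : 'I_m -> 'I_n) :
  (forall i j : 'I_m, i < j -> g i < g j)%N -> injective g.
Proof.
move=> g_incr i j gij; apply: val_inj; case: (ltngtP i j) => // /g_incr;
  by rewrite gij ltnn.
Qed.

Lemma sorted_enumT n : sorted (fun i j : 'I_n => i < j)%N (enum 'I_n).
Proof.
have := iota_ltn_sorted 0 n.
by rewrite -val_enum_ord sorted_map.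
Qed.

Lemma sorted_enum_ord n (X : {set 'I_n}) :
  sorted (fun i j : 'I_n => i < j)%N (enum X).
Proof.
rewrite /enum_mem; apply: sorted_filter; first by move=> j i k; apply: ltn_trans.
by rewrite -enumT sorted_enumT.
Qed.

Lemma enum_val_increasing n (X : {set 'I_n}) (i j : 'I_#|X|) :
  (i < j)%N -> (enum_val i < enum_val j)%N.
Proof.
move=> ij; pose d := enum_val i.
rewrite (enum_val_nth d i) (enum_val_nth d j).
have tr : transitive (fun k l : 'I_n => k < l)%N.
  by move=> l k p; apply: ltn_trans.
have szE (k : 'I_#|X|) : val k \in gtn (size (enum X)).
  by rewrite inE -cardE ltn_ord.
exact: (sorted_ltn_nth tr d (sorted_enum_ord X) _ _ (szE i) (szE j) ij).
Qed.

(** Two strictly increasing lists with the same elements are equal, so an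
    increasing bijection onto X can only be the enumeration of X. *)
Lemma increasing_enum_val n (X : {set 'I_n}) (g : 'I_#|X| -> 'I_n) :
  (forall i j : 'I_#|X|, i < j -> g i < g j)%N -> g @: [set: 'I_#|X|] = X ->
  g =1 enum_val.
Proof.
move=> g_incr gX i.
have enumX : map g (enum 'I_#|X|) = enum X.
  apply: (@irr_sorted_eq _ (fun i j : 'I_n => i < j)%N).
  - by move=> l k p; apply: ltn_trans.
  - by move=> k; rewrite /= ltnn.
  - pose lt p (i j : 'I_p) := (i < j)%N.
    exact: (@homo_sorted _ _ g (lt _) (lt _) g_incr _ (sorted_enumT _)).
  - exact: sorted_enum_ord.
  - move=> k; rewrite mem_enum -[in RHS]gX; apply/mapP/imsetP => -[j _ ->].
      by exists j.
    by exists j; rewrite // mem_enum.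
by rewrite (enum_val_nth (g i)) -enumX (nth_map i) ?size_enum_ord //
  nth_ord_enum.
Qed.

(** * Standardization *)

Lemma std_setK n (X : {set 'I_n}) (P : {set {set 'I_n}}) :
  partition P X ->
  [set enum_val @: (C : {set 'I_#|X|}) | C in std_set X P] = P.
Proof.
case/partitionP=> _ sub _ _.
rewrite /std_set -imset_comp -[RHS]imset_id; apply: eq_in_imset => B BP /=.
apply/setP=> x; apply/imsetP/idP => [[i]|xB]; first by rewrite inE => iB ->.
have xX := sub _ _ BP xB.
by exists (enum_rank_in xX x); rewrite ?inE enum_rankK_in.
Qed.

(** The characterization of the standardization: any set partition that an
    increasing map carries to P is the standardization of P.  It is stated in
    [spart] because m and #|X| are only propositionally equal, and it reduces
    every identity between standardizations to exhibiting an increasing map. *)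
Lemma std_unique m n (A : setpart m) (g : 'I_m -> 'I_n) (X : {set 'I_n})
    (P : {set {set 'I_n}}) (hP : partition P X) :
  (forall i j : 'I_m, i < j -> g i < g j)%N ->
  [set g @: (C : {set 'I_m}) | C in val A] = P ->
  Tagged setpart A = Tagged setpart (std hP).
Proof.
move=> g_incr gA; have g_inj := increasing_inj g_incr.
have gX : g @: [set: 'I_m] = X.
  case/partitionP: (valP A) => covA _ _ _; case/partitionP: (hP) => covP sub _ _.
  apply/setP=> x; apply/imsetP/idP=> [[i _ ->]|].
    have [C CA iC] := covA i (in_setT _).
    by apply: (sub (g @: C)); rewrite ?imset_f // -gA imset_f.
  case/covP=> B; rewrite -gA => /imsetP[C _ ->] /imsetP[i _ ->].
  by exists i.
have mX : m = #|X| by rewrite -gX card_imset // cardsT card_ord.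
subst m; congr existT; apply: val_inj => /=.
have gE := increasing_enum_val g_incr gX.
rewrite /std_set -gA -imset_comp -[LHS]imset_id; apply: eq_imset => C /=.
by apply/setP=> i; rewrite inE -gE mem_imset.
Qed.

Lemma nth_parts_inj n (A : setpart n) :
  injective (fun k : 'I_(nparts A) => nth set0 (parts A) k).
Proof.
move=> k l /eqP; rewrite nth_uniq ?size_parts //; first by move/eqP/val_inj.
by rewrite sort_uniq enum_uniq.
Qed.

Lemma card_subparts n (A : setpart n) (K : {set 'I_(nparts A)}) :
  #|subparts A K| = #|K|.
Proof. exact/card_imset/nth_parts_inj. Qed.

Lemma subpartsT n (A : setpart n) : subparts A setT = val A.
Proof.
apply/eqP; rewrite eqEcard subparts_sub.
by rewrite card_subparts cardsT card_ord /=.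
Qed.

Lemma std_subT n (A : setpart n) : std_sub A setT = Tagged setpart A.
Proof.
symmetry; apply: (std_unique (g := id)) => //.
by rewrite subpartsT (eq_imset (g := id)) ?imset_id // => C; apply: imset_id.
Qed.

Lemma tag_std_sub_eq0 n (A : setpart n) K :
  (tag (std_sub A K) == 0%N) = (K == set0).
Proof.
rewrite /= cards_eq0; apply/eqP/eqP => [cov0|->].
  case: (set_0Vmem K) => // -[k kK]; case/partitionP: (valP A) => _ _ _ /negP[].
  have BA : nth set0 (parts A) k \in val A.
    by rewrite -mem_parts mem_nth // size_parts.
  suff <- : nth set0 (parts A) k = set0 by [].
  apply/eqP; rewrite -subset0.
  apply: (@subset_trans _ _ (cover (subparts A K))); last by rewrite cov0.
  by apply: (@bigcup_sup _ _ _ _ (fun B : {set _} => B)); apply: imset_f.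
by rewrite /cover big1 // => B /imsetP[k]; rewrite inE.
Qed.

Lemma std_sub_eq0 n (A : setpart n) K : (std_sub A K == sempty) = (K == set0).
Proof.
rewrite -tag_std_sub_eq0; apply/eqP/eqP => [->//|].
exact: spart0.
Qed.

Lemma std_sub0 n (A : setpart n) : std_sub A set0 = sempty.
Proof. by apply/eqP; rewrite std_sub_eq0. Qed.

(** Standardization carries the parts of A indexed by K to the parts of B; phi
    is the resulting matching of indices.  Restricting B further and
    standardizing again amounts to one standardization, because the composite
    of two increasing enumerations is increasing. *)
Lemma std_sub_std_sub n (A : setpart n) (K : {set 'I_(nparts A)}) :
  let B := std (subparts_partition K) in
  exists phi : 'I_(nparts B) -> 'I_(nparts A),
  [/\ injective phi, phi @: [set: 'I_(nparts B)] = K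
    & forall J, std_sub B J = std_sub A (phi @: J)].
Proof.
move=> B; pose X := cover (subparts A K).
pose ev (i : 'I_#|X|) : 'I_n := enum_val i.
pose im_ev (C : {set 'I_#|X|}) := ev @: C.
have BK : im_ev @: val B = subparts A K by apply/std_setK/subparts_partition.
have im_ev_inj : injective im_ev by apply: imset_inj; apply: enum_val_inj.
have [j|phi phiP] := @fin_all_exists 'I_(nparts B) (fun=> 'I_(nparts A))
    (fun j k => k \in K /\
       im_ev (nth set0 (parts B) j) = nth set0 (parts A) k).
  have : im_ev (nth set0 (parts B) j) \in im_ev @: val B.
    by rewrite imset_f // -mem_parts mem_nth // size_parts.
  by rewrite BK => /imsetP[k kK ->]; exists k.
have phi_inj : injective phi.
  move=> j l jl; apply: nth_parts_inj; apply: im_ev_inj => /=.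
  by rewrite (phiP j).2 (phiP l).2 jl.
exists phi; split=> // [|J].
  apply/eqP; rewrite eqEcard; apply/andP; split.
    by apply/subsetP=> _ /imsetP[j _ ->]; case: (phiP j).
  rewrite card_imset // cardsT card_ord /nparts -(card_imset _ im_ev_inj) BK.
  by rewrite card_subparts.
apply: (std_unique (g := ev \o enum_val)) => [i j ij|].
  by do 2!apply: enum_val_increasing.
have JE := std_setK (subparts_partition J).
rewrite (eq_imset (g := im_ev \o (fun C : {set 'I_#|cover (subparts B J)|} =>
  enum_val @: C))); last by move=> C; apply: imset_comp.
rewrite imset_comp JE /subparts -!imset_comp; apply: eq_imset => j /=.
by case: (phiP j).
Qed.

(** * Convolution of linear maps *)

Lemma mul_tensor_sum (f g : {linear NCSym -> NCSym}) (I : finType) (P : pred I)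
    (p : I -> spart * spart) :
  mul_tensor f g (\sum_(i | P i) << p i >>) =
  \sum_(i | P i) f << (p i).1 >> * g << (p i).2 >>.
Proof.
set h := fun q : spart * spart => f << q.1 >> * g << q.2 >>.
(* This form is additive in t, whatever the support of t. *)
have mE t : mul_tensor f g t = mmap (@malgC spart rat) h t.
  by apply: eq_bigr => q _; rewrite mul_malgC.
by rewrite mE raddf_sum; apply: eq_bigr => i _; rewrite /= mmapU /= mul1r.
Qed.

(** The coproduct of A_K, reindexed by subsets of K: this keeps the recursion
    for the antipode among the subsets of one fixed index set. *)
Lemma convolution_std_sub (f g : {linear NCSym -> NCSym}) n (A : setpart n)
    (K : {set 'I_(nparts A)}) :
  convolution f g << std_sub A K >> =
  \sum_(L : {set 'I_(nparts A)} | L \subset K)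
     f << std_sub A L >> * g << std_sub A (K :\: L) >>.
Proof.
have [phi [phi_inj phiT phiE]] := std_sub_std_sub K.
set B := std (subparts_partition K) in phi phi_inj phiT phiE *.
rewrite /convolution (coprod_basisE B) mul_tensor_sum /=.
(* An ordered pair of complementary subsets is determined by its first entry. *)
pose c (J : {set 'I_(nparts B)}) := (J, ~: J).
rewrite (reindex_onto c fst) => [|[J L] /= /andP[/eqP cov /eqP dis]]; last first.
  rewrite /c; congr pair; apply/setP=> k; move/setP/(_ k): cov.
  by move/setP/(_ k): dis; rewrite !inE; case: (k \in J); case: (k \in L).
rewrite (eq_bigl xpredT) => [|J]; last by rewrite /= setUCr setICr !eqxx.
(* Direct image under phi is a bijection onto the subsets of K. *)
pose phi' (L : {set 'I_(nparts A)}) := phi @^-1: L.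
rewrite [RHS](reindex_onto (fun J : {set _} => phi @: J) phi')
  => [|L LK]; last first.
  apply/setP=> k; apply/imsetP/idP => [[j]|kL]; first by rewrite inE => jL ->.
  have /imsetP[j _ kj] : k \in phi @: setT by rewrite phiT (subsetP LK).
  by exists j; rewrite ?inE -?kj.
apply: eq_big => [J|J _] /=.
  have -> : phi @: J \subset K by have := imsetS phi (subsetT J); rewrite phiT.
  by symmetry; apply/eqP/setP=> j; rewrite inE mem_imset.
rewrite !phiE; congr (_ * g << std_sub A _ >>).
apply/setP=> k; apply/imsetP/setDP => [[j]|[]].
  rewrite inE => jJ ->; rewrite mem_imset //; split=> //.
  by have := imset_f phi (in_setT j); rewrite phiT.
have KE l : l \in K -> l \in phi @: setT by rewrite phiT.
case/KE/imsetP=> j _ ->; rewrite mem_imset // => jJ.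
by exists j; rewrite ?inE.
Qed.

(** * Sums over set compositions *)

Lemma big_bseqS (V : nmodType) (T : finType) m (F : seq T -> V) :
  \sum_(g : m.+1.-bseq T) F g =
  F [::] + \sum_(x : T) \sum_(g : m.-bseq T) F (x :: g).
Proof.
rewrite (bigD1 [bseq]) //=; congr (_ + _).
rewrite pair_big /=.
pose h (p : T * m.-bseq T) : m.+1.-bseq T := [bseq of p.1 :: p.2].
pose h' (g : m.+1.-bseq T) : option (T * m.-bseq T) :=
  if val g is x :: _ then Some (x, [bseq of behead g]) else None.
rewrite (reindex_omap h h') => [|[[|x s] sm] // _]; last first.
  by rewrite /h' /=; congr Some; apply: val_inj.
apply: eq_bigl => -[x g]; rewrite /h' /=; apply/eqP; congr Some; congr pair.
exact: val_inj.
Qed.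

Lemma setcomp_nil r (K : {set 'I_r}) : setcomp K [::] = (K == set0).
Proof. by rewrite /setcomp /= big_nil eq_sym. Qed.

(** Pairwise disjointness of L :: g says that L is disjoint from the union of
    g, which turns the condition on the whole union into one on K :\: L. *)
Lemma setcomp_cons r (K L : {set 'I_r}) g :
  setcomp K (L :: g) = [&& L != set0, L \subset K & setcomp (K :\: L) g].
Proof.
have disE : all (fun C : {set 'I_r} => [disjoint L & C]) g =
            [disjoint L & \bigcup_(C <- g) C].
  elim: g => [|C g IH] /=; first by rewrite big_nil -setI_eq0 setI0 eqxx.
  by rewrite IH big_cons -!setI_eq0 setIUr setU_eq0.
rewrite /setcomp inE negb_or eq_sym /= disE big_cons.
set U := \bigcup_(C <- g) C; rewrite -!andbA; congr (_ && _).
case: (set0 \in g) => /=; first by rewrite !andbF.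
case: (pairwise _ g) => /=; last by rewrite !andbF.
apply/andP/andP => [[dLU /eqP<-]|[LK /eqP->]].
  rewrite subsetUl setDUl setDv set0U eq_sym; split=> //.
  by apply/eqP/setDidPl; rewrite disjoint_sym.
split; last by rewrite -[X in X :|: _](setIidPr LK) setID.
by rewrite -setI_eq0 setIDA setIC -setIDA setDv setI0.
Qed.

Lemma big_setcompS (V : nmodType) r m (K : {set 'I_r})
    (F : seq {set 'I_r} -> V) :
  K != set0 ->
  \sum_(g : m.+1.-bseq {set 'I_r} | setcomp K g) F g =
  \sum_(L : {set 'I_r} | (L != set0) && (L \subset K))
     \sum_(g : m.-bseq {set 'I_r} | setcomp (K :\: L) g) F (L :: g).
Proof.
move=> Kn0; rewrite big_mkcond.
rewrite (big_bseqS m (fun g => if setcomp K g then F g else 0)).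
rewrite setcomp_nil (negPf Kn0) add0r [RHS]big_mkcond.
apply: eq_bigr => L _; rewrite -big_mkcond /=.
case: ifP => LK; last by apply: big_pred0 => g; rewrite setcomp_cons andbA LK.
by apply: eq_bigl => g; rewrite setcomp_cons andbA LK.
Qed.

(** The bound m on the lengths is a parameter independent of K, so that it can
    drop by one when the first block is removed; the sum is over all
    compositions of K as soon as #|K| <= m. *)
Definition comp_sum n (A : setpart n) m (K : {set 'I_(nparts A)}) : NCSym :=
  \sum_(g : m.-bseq {set 'I_(nparts A)} | setcomp K g)
     (-1) ^+ size g *: << comp_act A g >>.

Lemma comp_sum0 n (A : setpart n) m :
  comp_sum m (set0 : {set 'I_(nparts A)}) = 1.
Proof.
rewrite /comp_sum (bigD1 [bseq]) ?setcomp_nil //= big1 => [|[[|L g] gm]].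
- by rewrite addr0 expr0 scale1r /comp_act big_nil.
- by rewrite andbF.
by rewrite /= setcomp_cons subset0 => /andP[/and3P[/negPf->]].
Qed.

Lemma comp_sumS n (A : setpart n) m (K : {set 'I_(nparts A)}) :
  K != set0 ->
  comp_sum m.+1 K =
  - \sum_(L : {set 'I_(nparts A)} | (L != set0) && (L \subset K))
      << std_sub A L >> * comp_sum m (K :\: L).
Proof.
move=> Kn0.
rewrite /comp_sum.
rewrite (big_setcompS m (fun g => (-1) ^+ size g *: << comp_act A g >>)) //.
rewrite -sumrN; apply: eq_bigr => L _; rewrite mulr_sumr -sumrN.
apply: eq_bigr => g _; rewrite exprS mulN1r scaleNr; congr (- _).
have -> : << comp_act A (L :: g) >> =
    << std_sub A L >> * << comp_act A g >> :> NCSym.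
  by rewrite /comp_act big_cons malgM_def fgmulUU mulr1.
by rewrite -signr_odd !scaler_sign; case: odd; rewrite ?mulrN.
Qed.

(** * The antipode *)

Lemma antipode_std_sub (S : {linear NCSym -> NCSym}) (hS : is_antipode S)
    n (A : setpart n) (K : {set 'I_(nparts A)}) :
  \sum_(L : {set 'I_(nparts A)} | L \subset K)
     << std_sub A L >> * S << std_sub A (K :\: L) >> = (K == set0)%:R.
Proof.
have := hS.2 << std_sub A K >>; rewrite convolution_std_sub /= => ->.
by rewrite /counit mcoeffU1 std_sub_eq0; case: eqP; rewrite ?scale1r ?scale0r.
Qed.

Lemma antipode_sempty (S : {linear NCSym -> NCSym}) :
  is_antipode S -> S << sempty >> = 1.
Proof.
pose A : setpart 0 := tagged sempty; move=> hS.
have := antipode_std_sub hS (set0 : {set 'I_(nparts A)}).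
rewrite eqxx (big_pred1 set0) => [|L]; last exact: subset0.
rewrite setD0 std_sub0 => SE; apply: etrans SE; symmetry; exact: mul1r.
Qed.

(** The convolution identity solved for its term with L empty. *)
Lemma antipode_rec (S : {linear NCSym -> NCSym}) n (A : setpart n)
    (K : {set 'I_(nparts A)}) :
  is_antipode S -> K != set0 ->
  S << std_sub A K >> =
  - \sum_(L : {set 'I_(nparts A)} | (L != set0) && (L \subset K))
      << std_sub A L >> * S << std_sub A (K :\: L) >>.
Proof.
move=> hS Kn0.
pose G L : NCSym := << std_sub A L >> * S << std_sub A (K :\: L) >>.
have G0 : G set0 = S << std_sub A K >>.
  by rewrite /G setD0 std_sub0; apply: mul1r.
have sumG : \sum_(L : {set 'I_(nparts A)} | L \subset K) G L = 0.
  by have := antipode_std_sub hS K; rewrite (negPf Kn0).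
rewrite (bigD1 set0) ?sub0set //= in sumG.
apply: etrans (esym G0) _; apply/eqP; rewrite -addr_eq0 -[X in _ == X]sumG.
by apply/eqP; congr (_ + _); apply: eq_bigl => L; rewrite andbC.
Qed.

Lemma antipode_comp_sum (S : {linear NCSym -> NCSym}) (hS : is_antipode S)
    n (A : setpart n) m (K : {set 'I_(nparts A)}) :
  (#|K| <= m)%N -> S << std_sub A K >> = comp_sum m K.
Proof.
have S0 : S << std_sub A set0 >> = 1.
  by rewrite std_sub0; apply: antipode_sempty.
elim: m K => [|m IH] K Km.
  by move: Km; rewrite leqn0 cards_eq0 => /eqP->; rewrite comp_sum0.
have [->|Kn0] := eqVneq K set0; first by rewrite comp_sum0.
apply: etrans (antipode_rec hS Kn0) _.
apply: etrans _ (esym (comp_sumS m Kn0)); congr (- _).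
apply: eq_bigr => L /andP[Ln0 LK]; congr (_ * _); apply: IH.
rewrite -ltnS; apply: leq_trans Km; apply: proper_card; apply/properP.
split; first exact: subsetDl.
case: (set_0Vmem L) => [L0|[k kL]]; first by rewrite L0 eqxx in Ln0.
by exists k; rewrite ?(subsetP LK) // inE kL.
Qed.

Theorem theorem6 (S : {linear NCSym -> NCSym}) (hS : is_antipode S)
    (n : nat) (A : setpart n) :
  S (basis A) =
  \sum_(g : (nparts A).-bseq {set 'I_(nparts A)}
         | setcomp [set: 'I_(nparts A)] g)
     (-1) ^+ size g *: << comp_act A g >>.
Proof.
rewrite /basis -(std_subT A).
by apply: (antipode_comp_sum hS); rewrite cardsT card_ord.
Qed.
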